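(* Let $k=\mathbb F_q$ with $q=p^m$, $p>3$ prime. For any $c>0$ there exists $t=t(c,q)>0$ such that $b(P)\le t(c,q)$ for every nonzero homogeneous cubic polynomial $P$ on a finite-dimensional $k$-vector space $V$ with $r(P)\le c$. Moreover there exists $N(c,q)$ such that for every nonzero homogeneous cubic polynomial $P$ on a finite-dimensional $k$-vector space $V$ with $r(P)\le c$ one has $b_n(P)\le t(c,q)$ for some $n\le N(c,q)$.
   Context: For $n\ge 1$ let $k_n/k$ be the extension of degree $n$, $\psi:k\to\mathbb C^\star$ a fixed non-trivial additive character, $\psi_n=\psi\circ\operatorname{tr}_{k_n/k}$. For a polynomial $P$ on $V$ set $a_n(P)=\sum_{v\in V(k_n)}\psi_n(P(v))$, $\tilde b_n(P)=|a_n(P)|/q^{n\dim V}$, $b_n(P)=-2\log_{q^n}(\tilde b_n(P))$ (with $-\log_{q^n}(0)=\infty$), and $b(P)=\liminf_n b_n(P)$. The algebraic rank $r(P)$ of a nonzero homogeneous polynomial $P$ of degree $\ge 2$ is $2r$, where $r$ is the minimal number such that $P=\sum_{i=1}^r l_iR_i$ with $l_i,R_i$ homogeneous polynomials of positive degree with coefficients in the algebraic closure $\bar k$. *)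

(* Defs.v *)
From HB Require Import structures.
From mathcomp Require Import all_boot all_order all_algebra all_field.
(* To be imported before mathcomp-analysis: in the other order, the notation
   levels clash. *)
From mathcomp Require Import mpoly.
From mathcomp Require Import all_classical all_reals all_analysis.
From mathcomp Require Import complex.

Set Implicit Arguments.
Unset Strict Implicit.
Unset Printing Implicit Defensive.

Import Order.TTheory GRing.Theory Num.Theory.
Local Open Scope ring_scope.

Section AlgebraicRank.
Variables (k : fieldType) (kbar : closedFieldType) (iota : {rmorphism k -> kbar}).
Variable d : nat.

Definition has_rank_decomp (P : {mpoly k[d]}) (r : nat) : Prop :=
  exists l Q : 'I_r -> {mpoly kbar[d]},
    [/\ forall i, exists2 e, (0 < e)%N & l i \is e.-homog,
        forall i, exists2 e, (0 < e)%N & Q i \is e.-homog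
      & map_mpoly iota P = \sum_(i < r) l i * Q i].

(* Twice the minimal length of a decomposition. The default value 0 of [xget]
   only occurs for polynomials without any decomposition, hence never for a
   homogeneous polynomial of degree >= 2. *)
Definition alg_rank (P : {mpoly k[d]}) : nat :=
  (2 * xget 0 [set r | has_rank_decomp P r /\
                       forall s, has_rank_decomp P s -> r <= s])%N.

End AlgebraicRank.

Section Trace.
Variables (k : fieldType) (L : fieldExtType k).

(* Trace of the k-linear endomorphism y |-> x * y of L. *)
Definition ext_trace (x : L) : k :=
  \sum_(i < \dim {:L}) coord (vbasis {:L}) i (x * (vbasis {:L})`_i).

End Trace.

Section Bias.
Variables (R : realType) (k : finFieldType).

Definition additive_character (psi : k -> R[i]) : Prop :=
  (forall x, psi x != 0) /\ (forall x y, psi (x + y) = psi x * psi y).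

Definition nontrivial (psi : k -> R[i]) : Prop := exists x, psi x != 1.

Variables (psi : k -> R[i]) (L : nat -> fieldExtType k) (d : nat).
Implicit Type P : {mpoly k[d]}.

Definition psi_ (n : nat) (x : L n) : R[i] := psi (ext_trace x).

(* [finvect_type (L n)] is the field [L n] with its finType structure. *)
Definition a_ P (n : nat) : R[i] :=
  \sum_(v : {ffun 'I_d -> finvect_type (L n)})
    psi_ ((map_mpoly (in_alg (L n)) P).@[v]).

Definition tilde_b_ P (n : nat) : R :=
  ComplexField.Normc.normc (a_ P n) / #|k|%:R ^+ (n * d).

Definition b_ P (n : nat) : \bar R :=
  if tilde_b_ P n == 0 then +oo%E
  else (- 2 * (ln (tilde_b_ P n) / ln (#|k|%:R ^+ n)))%:E.

Definition b_inf P : \bar R := limn_einf (b_ P).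

End Bias.

(* Main.v *)
(** The cubic form [P] is [v |-> T(v, v, v)] for a symmetric trilinear form [T].

    Descent. Over the algebraic closure, let [N] be the sum of all isotropic
    subspaces of codimension at most [r]. It is a sum of at most [r + 1] of them,
    and on their intersection [U] one has [T(U, U, N) = 0]. Hence the radical
    [{u in N | T(u, N, N) = 0}] has codimension bounded in terms of [r]; it is
    isotropic, and it is defined over [k] because [N] is Frobenius stable.

    Bias. Let [W] be isotropic of codimension at most [D] over a field with [q]
    elements and [K = {v | T(v, W, W) = 0}]. If for some [v] outside [K] the
    radical of [T(v, _, _)] on [W] has small codimension in [W], replace [W] by
    that radical: [K] grows, so this happens boundedly often. Otherwise Weyl
    differencing makes the [W]-cosets outside [K] negligible, and the cosets in
    [K] contribute the sum [S] of [psi(P(v))] over the cone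
    [Y = {v in K | T(v, v, W) = 0}], on which [P] is [W]-invariant.

    Nonvanishing of [S]. When [6] divides the degree of the field extension, all
    of [F_p^*] consists of cubes. The group [G] of all [g] with [g^3] in [F_p^*]
    times [W] acts freely on [Y \ W], and averaging over [G] makes [S] equal to
    [|W| (1 + 3 z)] with [z] an integer. So [|S| >= |W|]. *)
Require Import Defs.
From HB Require Import structures.
From mathcomp Require Import all_boot all_order all_algebra all_field.
From mathcomp Require Import mpoly.
From mathcomp Require Import all_classical all_reals all_analysis.
From mathcomp Require Import complex.
From mathcomp Require Import cyclic mxabelem.
From mathcomp Require Import ring lra zify.

Set Implicit Arguments.
Unset Strict Implicit.
Unset Printing Implicit Defensive.

Import Order.TTheory GRing.Theory Num.Theory.
Local Open Scope ring_scope.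

(** * Symmetric trilinear forms and isotropic subspaces *)

Definition sym3 (F : Type) (d : nat) (c : 'I_d -> 'I_d -> 'I_d -> F) : Prop :=
  (forall i j k, c i j k = c j i k) /\ (forall i j k, c i j k = c i k j).

Section Polar.
Variables (F : fieldType) (d : nat) (c : 'I_d -> 'I_d -> 'I_d -> F).

Definition polar (u : 'rV[F]_d) : 'M[F]_d := \matrix_(j, k) \sum_i u 0 i * c i j k.

Fact polar_is_linear : linear polar.
Proof.
move=> a u v; apply/matrixP => j k; rewrite !mxE mulr_sumr -big_split /=.
by apply: eq_bigr => i _; rewrite !mxE mulrDl mulrA.
Qed.

HB.instance Definition _ :=
  GRing.isLinear.Build F 'rV[F]_d 'M[F]_d _ polar polar_is_linear.

Definition tri (u v w : 'rV[F]_d) : F := (v *m polar u *m w^T) 0 0.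

Lemma tri_mx u v w : tri u v w = (v *m polar u *m w^T) 0 0.
Proof. by []. Qed.

Definition cubic (v : 'rV[F]_d) : F := tri v v v.

Lemma triE u v w : tri u v w = \sum_i \sum_j \sum_k c i j k * u 0 i * v 0 j * w 0 k.
Proof.
rewrite /tri mxE (eq_bigr (fun k => \sum_j \sum_i c i j k * u 0 i * v 0 j * w 0 k)).
  rewrite exchange_big /= [RHS]exchange_big /=; apply: eq_bigr => j _.
  by rewrite exchange_big.
move=> k _; rewrite !mxE mulr_suml; apply: eq_bigr => j _; rewrite !mxE.
rewrite mulr_sumr mulr_suml; apply: eq_bigr => i _; ring.
Qed.

Lemma triDl u u' v w : tri (u + u') v w = tri u v w + tri u' v w.
Proof. by rewrite /tri linearD /= mulmxDr mulmxDl mxE. Qed.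
Lemma triDm u v v' w : tri u (v + v') w = tri u v w + tri u v' w.
Proof. by rewrite /tri !mulmxDl mxE. Qed.
Lemma triDr u v w w' : tri u v (w + w') = tri u v w + tri u v w'.
Proof. by rewrite /tri linearD /= mulmxDr mxE. Qed.
Lemma triZl a u v w : tri (a *: u) v w = a * tri u v w.
Proof. by rewrite /tri linearZ /= -scalemxAr -scalemxAl mxE. Qed.
Lemma triZm a u v w : tri u (a *: v) w = a * tri u v w.
Proof. by rewrite /tri -!scalemxAl mxE. Qed.
Lemma triZr a u v w : tri u v (a *: w) = a * tri u v w.
Proof. by rewrite /tri linearZ /= -scalemxAr mxE. Qed.

Lemma cubicZ a v : cubic (a *: v) = a ^+ 3 * cubic v.
Proof. by rewrite /cubic triZl triZm triZr; ring. Qed.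

(** Written as the kernel of the flattened map [u |-> B *m polar u *m B^T], so that its rank and its
    behaviour under field morphisms come from [kermx]. *)
Definition annih m (B : 'M[F]_(m, d)) : 'M[F]_d :=
  kermx (lin1_mx (mxvec \o (mulmxr B^T \o (mulmx B \o polar)))).

Lemma sub_annih m (B : 'M[F]_(m, d)) u :
  (u <= annih B)%MS = (B *m polar u *m B^T == 0).
Proof.
rewrite sub_kermx mul_rV_lin1 /=.
by rewrite -[RHS](inj_eq (can_inj mxvecK)) linear0.
Qed.

Lemma annihP m (B : 'M[F]_(m, d)) u :
  reflect (forall v w, (v <= B)%MS -> (w <= B)%MS -> tri u v w = 0)
          (u <= annih B)%MS.
Proof.
rewrite sub_annih; apply: (iffP eqP) => [B0 v w /submxP[x ->] /submxP[y ->]|B0].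
  by rewrite /tri trmx_mul !mulmxA -(mulmxA x) -(mulmxA x) B0 mulmx0 mul0mx mxE.
apply/matrixP => i j; rewrite [RHS]mxE.
have := B0 (row i B) (row j B) (row_sub _ _) (row_sub _ _).
rewrite /tri -!row_mul => <-; set X := B *m _; rewrite [LHS]mxE [RHS]mxE [RHS]mxE.
by apply: eq_bigr => k _; congr (_ * _); rewrite !mxE.
Qed.

Lemma mxrank_annih m (B : 'M[F]_(m, d)) : (d <= \rank (annih B) + m * m)%N.
Proof.
rewrite mxrank_ker -leq_subLR; set r := \rank _.
have: (r <= m * m)%N by exact: rank_leq_col.
have: (r <= d)%N by exact: rank_leq_row.
lia.
Qed.

Definition isotropic m (W : 'M[F]_(m, d)) : bool := (W <= annih W)%MS.

Lemma isotropicP m (W : 'M[F]_(m, d)) :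
  reflect (forall u v w, (u <= W)%MS -> (v <= W)%MS -> (w <= W)%MS -> tri u v w = 0)
          (isotropic W).
Proof.
apply: (iffP rV_subP) => [W0 u v w uW|W0 u uW]; last by apply/annihP => v w; exact: W0.
by move/annihP: (W0 u uW); apply.
Qed.

Lemma isotropicS m n (W : 'M[F]_(m, d)) (W' : 'M[F]_(n, d)) :
  (W' <= W)%MS -> isotropic W -> isotropic W'.
Proof.
move=> sW /isotropicP W0; apply/isotropicP => u v w uW vW wW.
by apply: W0; apply: submx_trans sW.
Qed.

Lemma annihS m n (W : 'M[F]_(m, d)) (W' : 'M[F]_(n, d)) :
  (W' <= W)%MS -> (annih W <= annih W')%MS.
Proof.
move=> sW; apply/rV_subP => u /annihP uW; apply/annihP => v w vW wW.
by apply: uW; apply: submx_trans sW.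
Qed.

Hypothesis c_sym : sym3 c.

Lemma triCl u v w : tri u v w = tri v u w.
Proof.
rewrite !triE exchange_big /=; apply: eq_bigr => i _; apply: eq_bigr => j _.
by apply: eq_bigr => k _; rewrite c_sym.1; ring.
Qed.

Lemma triCr u v w : tri u v w = tri u w v.
Proof.
rewrite !triE; apply: eq_bigr => i _; rewrite exchange_big /=; apply: eq_bigr => j _.
by apply: eq_bigr => k _; rewrite c_sym.2; ring.
Qed.

Lemma cubicD u v :
  cubic (u + v) = cubic u + 3 * tri u u v + 3 * tri u v v + cubic v.
Proof.
rewrite /cubic !(triDl, triDm, triDr).
rewrite (triCl v u u) (triCr u v u) (triCl v u v) (triCr v v u) (triCl v u v); ring.
Qed.

(** Polarization: on [W] the values at [u + v] and [u - v] differ by [6 * tri u u v]. Replacing [u]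
    by [u + v] in [tri u u w] then isolates [2 * tri u v w]. *)
Lemma isotropic_cubic (six_neq0 : 6 != 0 :> F) m (W : 'M[F]_(m, d)) :
  (forall v, (v <= W)%MS -> cubic v = 0) -> isotropic W.
Proof.
move=> W0; have two_neq0 : 2 != 0 :> F.
  by apply: contraNneq six_neq0; rewrite (_ : 6 = 3 * 2); [move=> ->; rewrite mulr0|ring].
have W1 u v : (u <= W)%MS -> (v <= W)%MS -> tri u u v = 0.
  move=> uW vW; have /W0 := addmx_sub uW vW.
  have NvW : (- v <= W)%MS by rewrite eqmx_opp.
  have /W0 := addmx_sub uW NvW.
  rewrite !cubicD -scaleN1r cubicZ !triZr !triZm !W0 // => e1 e2.
  apply: (mulfI six_neq0); rewrite mulr0.
  move: (tri u u v) (tri u v v) e1 e2 => x y e1 e2.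
  have -> : 6 * x = 0 + 3 * x + 3 * y + 0 - (0 + 3 * (-1 * x) + 3 * (-1 * (-1 * y)) + (-1) ^+ 3 * 0)
    by ring.
  by rewrite e1 e2 subr0.
apply/isotropicP => u v w uW vW wW.
have := W1 (u + v) w (addmx_sub uW vW) wW.
rewrite !(triDl, triDm) !W1 // (triCl v u) add0r addr0 => /eqP.
by rewrite -mulr2n -mulr_natl mulf_eq0 (negPf two_neq0) => /eqP.
Qed.

End Polar.

(** * Base change of trilinear forms *)

Section MapPolar.
Variables (F K : fieldType) (f : {rmorphism F -> K}) (d : nat).
Variable c : 'I_d -> 'I_d -> 'I_d -> F.

Local Notation fc := (fun i j k => f (c i j k)).

Lemma sym3_map : sym3 c -> sym3 fc.
Proof. by move=> [cl cr]; split=> i j k /=; [rewrite cl|rewrite cr]. Qed.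

Lemma map_polar u : map_mx f (polar c u) = polar fc (map_mx f u).
Proof.
apply/matrixP => j k; rewrite !mxE rmorph_sum; apply: eq_bigr => i _.
by rewrite rmorphM !mxE.
Qed.

Lemma map_annih m (B : 'M[F]_(m, d)) :
  map_mx f (annih c B) = annih fc (map_mx f B).
Proof.
rewrite /annih map_kermx; congr kermx; apply: map_lin1_mx => u /=.
by rewrite map_mxvec !map_mxM map_trmx map_polar.
Qed.

Lemma map_isotropic m (W : 'M[F]_(m, d)) :
  isotropic c W -> isotropic fc (map_mx f W).
Proof. by rewrite /isotropic -map_annih map_submx. Qed.

End MapPolar.

(** * Exponential sums over finite fields *)

Lemma submxDr (F : fieldType) (d m : nat) (W : 'M[F]_(m, d)) (u v : 'rV_d) :
  (v <= W)%MS -> ((u + v)%R <= W)%MS = (u <= W)%MS.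
Proof.
move=> vW; apply/idP/idP => [uvW|uW]; last exact: addmx_sub.
by rewrite -(addrK v u) addmx_sub // eqmx_opp.
Qed.

Section FiniteSums.
Variables (F : finFieldType) (d : nat).
Implicit Types (W : 'M[F]_d) (u v w : 'rV[F]_d).

Lemma card_sub_rV W : #|[set w : 'rV[F]_d | (w <= W)%MS]| = (#|F| ^ \rank W)%N.
Proof. by rewrite -card_rowg; apply: eq_card => w; rewrite !inE. Qed.

Lemma sum_sub_const (C : nzRingType) W (x : C) :
  \sum_(w : 'rV[F]_d | (w <= W)%MS) x = (#|F| ^ \rank W)%:R * x.
Proof. by rewrite sumr_const -card_sub_rV mulr_natl cardsE. Qed.

Lemma sum_sub_shift (C : nzRingType) W (f : 'rV[F]_d -> C) w0 : (w0 <= W)%MS ->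
  \sum_(w : 'rV[F]_d | (w <= W)%MS) f w = \sum_(w : 'rV[F]_d | (w <= W)%MS) f (w + w0).
Proof.
move=> w0W; rewrite (reindex_inj (addIr w0)) /=.
by apply: eq_bigl => w; rewrite submxDr.
Qed.

(* [G] acts by scaling and [W] by translation; the resulting group acts freely
   off [W]. *)
Lemma dvdn_card_orbits (G : {set F}) W (D : {set 'rV[F]_d}) :
    1 \in G -> 0 \notin G ->
    {in G &, forall x y, x * y \in G} -> {in G, forall x, x^-1 \in G} ->
    (forall v, v \in D -> ~~ (v <= W)%MS) ->
    (forall g v w, g \in G -> v \in D -> (w <= W)%MS -> g *: v + w \in D) ->
  (#|G| * #|F| ^ \rank W %| #|D|)%N.
Proof.
move=> G1 G0 GM GV DW Dcl.
have Gneq0 g : g \in G -> g != 0 by apply: contraTneq => ->.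
pose R v v' := [exists g in G, (v' - g *: v <= W)%MS].
have Rref v : R v v by apply/exists_inP; exists 1; rewrite // scale1r subrr sub0mx.
have Rsym v v' : R v v' -> R v' v.
  case/exists_inP => g gG vW; apply/exists_inP; exists g^-1; first exact: GV.
  have -> : v - g^-1 *: v' = - g^-1 *: (v' - g *: v).
    by rewrite scalerBr scalerA mulNr mulVf ?Gneq0 // scaleNr scaleN1r opprK addrC.
  exact: scalemx_sub.
have Rtrans v v' v'' : R v v' -> R v' v'' -> R v v''.
  case/exists_inP => g gG vW /exists_inP[h hG wW]; apply/exists_inP.
  exists (h * g); first exact: GM.
  have -> : v'' - (h * g) *: v = (v'' - h *: v') + h *: (v' - g *: v).
    by rewrite scalerBr scalerA addrA subrK.
  by rewrite addmx_sub // scalemx_sub.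
have Req : {in D & &, equivalence_rel R}.
  move=> x y z _ _ _; split=> // Rxy; apply/idP/idP; first exact/Rtrans/Rsym.
  exact: Rtrans.
rewrite mulnC.
rewrite (@card_uniform_partition _ (#|G| * #|F| ^ \rank W) _ _ _ (equivalence_partitionP Req)).
  by rewrite mulnC dvdn_mull.
move=> _ /imsetP[x xD ->].
(* The pairs [(g, w)] parametrize the class of [x] through [g *: x + w]; equal images with different
   scalars would put [x] in [W]. *)
rewrite -card_sub_rV -cardsX -(@card_in_imset _ _ (fun gw => gw.1 *: x + gw.2)).
  apply: eq_card => y; rewrite inE; apply/andP/imsetP => [[yD]|[[g w]]].
    case/exists_inP => g gG yW; exists (g, y - g *: x); first by rewrite !inE gG.
    by rewrite /= addrC subrK.
  rewrite !inE /= => /andP[gG wW] ->; split; first exact: Dcl.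
  by apply/exists_inP; exists g => //; rewrite addrC addKr.
case=> g w [h z]; rewrite !inE /= => /andP[gG wW] /andP[hG zW] /= e.
have ghx : (g - h) *: x = z - w.
  by rewrite scalerBl; apply/eqP; rewrite subr_eq addrAC [z + _]addrC -e addrK.
have gh : g = h.
  apply/eqP; rewrite -subr_eq0; apply: contraTT (DW _ xD) => nz; rewrite negbK.
  rewrite -(scale1r x) -(mulVf nz) -scalerA ghx scalemx_sub // addmx_sub //.
  by rewrite eqmx_opp.
by rewrite -gh in e *; move/addrI: e => ->.
Qed.

End FiniteSums.

(** * Additive characters and Weyl differencing *)

Section Character.
Variables (F : finFieldType) (C : numClosedFieldType) (Psi : F -> C) (p : nat).
Hypotheses (p_prime : prime p) (charFp : p \in [pchar F]).
Hypotheses (Psi_neq0 : forall x, Psi x != 0).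
Hypothesis PsiD : forall x y, Psi (x + y) = Psi x * Psi y.
Hypothesis Psi_nontriv : exists x, Psi x != 1.

Lemma char0 : Psi 0 = 1.
Proof. by apply: (mulfI (Psi_neq0 0)); rewrite -PsiD addr0 mulr1. Qed.

Lemma charMn x n : Psi (x *+ n) = Psi x ^+ n.
Proof. by elim: n => [|n IHn]; rewrite ?mulr0n ?char0 // mulrS PsiD IHn exprS. Qed.

Lemma charX x : Psi x ^+ p = 1.
Proof. by rewrite -charMn -mulr_natr (pcharf0 charFp) mulr0 char0. Qed.

Lemma norm_char x : `|Psi x| = 1.
Proof.
apply/eqP; rewrite -(@pexpr_eq1 _ _ p) ?prime_gt0 //.
by rewrite -normrX charX normr1.
Qed.

Lemma charN x : Psi (- x) = (Psi x)^*.
Proof.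
apply: (mulfI (Psi_neq0 x)); rewrite -PsiD subrr char0 -normCK norm_char expr1n //.
Qed.

Section Weyl.
Variables (d : nat) (c : 'I_d -> 'I_d -> 'I_d -> F).
Hypotheses (c_sym : sym3 c) (six_neq0 : 6 != 0 :> F).
Variable W : 'M[F]_d.
Hypothesis W_iso : isotropic c W.

Local Notation tri := (tri c).
Local Notation cubic := (cubic c).

(** Translating by a multiple of [w0] at which [Psi (l _)] is not 1 multiplies the sum by that
    value. *)
Lemma char_sum0 (l : 'rV[F]_d -> F) w0 :
    (forall v w, l (v + w) = l v + l w) -> (forall a v, l (a *: v) = a * l v) ->
    (w0 <= W)%MS -> l w0 != 0 ->
  \sum_(w : 'rV[F]_d | (w <= W)%MS) Psi (l w) = 0.
Proof.
move=> lD lZ w0W lw0; have [x Px] := Psi_nontriv.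
have x0W : ((x / l w0) *: w0 <= W)%MS by rewrite scalemx_sub.
apply/eqP; have /eqP := sum_sub_shift (fun w => Psi (l w)) x0W.
under [X in _ == X]eq_bigr => w _ do rewrite lD lZ divfK // PsiD mulrC.
rewrite -mulr_sumr -subr_eq0 -{1}[\sum_(_ | _) _]mul1r -mulrBl mulf_eq0.
by rewrite subr_eq0 eq_sym (negPf Px).
Qed.

Definition radical v := (W :&: kermx (polar c v *m W^T))%MS.

Lemma radicalP v h : reflect ((h <= W)%MS /\ forall w, (w <= W)%MS -> tri v h w = 0)
  (h <= radical v)%MS.
Proof.
rewrite sub_capmx; apply: (iffP andP) => [[hW hk]|[hW h0]]; split=> //.
  move: hk; rewrite sub_kermx mulmxA => /eqP h0 w /submxP[x ->].
  by rewrite tri_mx trmx_mul mulmxA h0 mul0mx mxE.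
rewrite sub_kermx mulmxA; apply/eqP/rowP => i; rewrite [RHS]mxE.
have := h0 (row i W) (row_sub _ _); rewrite tri_mx => <-.
by rewrite [LHS]mxE [RHS]mxE; apply: eq_bigr => k _; congr (_ * _); rewrite !mxE.
Qed.

(** Squaring the sum and writing one variable as a shift of the other by [h] leaves an exponent
    affine in [w], as [cubic] vanishes on [W]. Its linear part [6 * tri v h w] makes the inner sum
    vanish unless [h] lies in the radical. *)
Lemma weyl_bound v :
  `|\sum_(w : 'rV[F]_d | (w <= W)%MS) Psi (cubic (v + w))| ^+ 2
    <= (#|F| ^ (\rank W + \rank (radical v)))%:R.
Proof.
have W0 := isotropicP _ _ W_iso.
have cub0 w : (w <= W)%MS -> cubic w = 0 by move=> wW; exact: W0.
pose f w := cubic (v + w).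
have fD w h : (w <= W)%MS -> (h <= W)%MS ->
    f (w + h) - f w = 3 * tri v v h + 3 * tri v h h + 6 * tri v h w.
  move=> wW hW; rewrite /f !(cubicD c_sym v) !(triDm, triDr).
  rewrite (cub0 _ wW) (cub0 _ (addmx_sub wW hW)) (triCr c_sym v w h).
  move: (tri v v w) (tri v v h) (tri v w w) (tri v h w) (tri v h h) (cubic v) => *.
  ring.
have E : `|\sum_(w : 'rV[F]_d | (w <= W)%MS) Psi (f w)| ^+ 2 =
    \sum_(h : 'rV[F]_d | (h <= W)%MS) Psi (3 * tri v v h + 3 * tri v h h) *
      \sum_(w : 'rV[F]_d | (w <= W)%MS) Psi (6 * tri v h w).
  rewrite normCK rmorph_sum mulr_sumr /=.
  under eq_bigr => w wW do rewrite mulr_suml (sum_sub_shift _ wW).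
  rewrite exchange_big /=; apply: eq_bigr => h hW; rewrite mulr_sumr.
  apply: eq_bigr => w wW; rewrite -charN -!PsiD; congr Psi.
  by rewrite addrC [h + w]addrC -fD // addrC.
rewrite -[X in X <= _]ger0_norm ?exprn_ge0 ?normr_ge0 // E.
rewrite (bigID (fun h => (h <= radical v)%MS)) /= [X in _ + X]big1 ?addr0; last first.
  move=> h /andP[hW]; case/boolP: [exists w : 'rV[F]_d, (w <= W)%MS && (tri v h w != 0)].
    case/existsP => w /andP[wW nz] _.
    rewrite (@char_sum0 (fun w => 6 * tri v h w) w) ?mulr0 ?mulf_neq0 //.
      by move=> x y; rewrite triDr mulrDr.
    by move=> a x; rewrite triZr mulrCA.
  move=> /existsPn h0 /radicalP[]; split=> // w wW; apply/eqP.
  by have := h0 w; rewrite wW negbK.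
have -> : (#|F| ^ (\rank W + \rank (radical v)))%:R =
    \sum_(h : 'rV[F]_d | (h <= radical v)%MS) (#|F| ^ \rank W)%:R :> C.
  by rewrite sum_sub_const -natrM -expnD addnC.
rewrite [X in `|X| <= _](eq_bigl (fun h => (h <= radical v)%MS)); last first.
  by move=> h /=; apply: andb_idl => /radicalP[].
apply: le_trans (ler_norm_sum _ _ _) _.
apply: ler_sum => h /radicalP[hW h0]; rewrite normrM norm_char mul1r.
apply: le_trans (ler_norm_sum _ _ _) _.
under eq_bigr => w _ do rewrite norm_char.
by rewrite sum_sub_const mulr1.
Qed.

End Weyl.
End Character.

Lemma natr_pchar_eq0 (F : nzRingType) (p j : nat) : p \in [pchar F] -> (j < p)%N ->
  (j%:R == 0 :> F) = (j == 0)%N.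
Proof.
move=> charFp jp; rewrite -(dvdn_pcharf charFp); apply/idP/eqP => [|->]; last exact: dvdn0.
by case: j jp => // j jp /(dvdn_leq (ltn0Sn j)); rewrite leqNgt jp.
Qed.

(** * Cube roots of the elements of the prime field *)

Section Roots.
Variables (F : finFieldType) (p : nat).
Hypotheses (p_prime : prime p) (charFp : p \in [pchar F]).
Hypothesis dvdF : (3 * (p - 1) %| #|F| - 1)%N.

Lemma exists_generator : exists z : F, (#|F| - 1)%N.-primitive_root z.
Proof.
have F1 : (0 < #|F| - 1)%N by rewrite subn_gt0 finNzRing_gt1.
have := @has_prim_root F (#|F| - 1)%N (enum [pred x : F | x != 0]) F1.
case/(_ _ _ _)/hasP.
- apply/allP => x; rewrite mem_enum inE => nz; apply/unity_rootP.
  apply: (mulIf nz); rewrite -exprSr mul1r subn1 prednK ?expf_card //.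
  by rewrite (ltn_trans _ (finNzRing_gt1 F)).
- exact: enum_uniq.
- by rewrite -cardE; have := cardC1 (0 : F); rewrite -subn1 => <-; apply: eq_leq; apply: eq_card.
by move=> z _ zP; exists z.
Qed.

Lemma exists_cube_root1 : exists2 w : F, w != 1 & w ^+ 3 = 1.
Proof.
have [z zP] := exists_generator.
have d3 : (3 %| #|F| - 1)%N by apply: dvdn_trans dvdF; rewrite dvdn_mulr.
exists (z ^+ ((#|F| - 1) %/ 3)); last by rewrite -exprM divnK // prim_expr_order.
rewrite -(prim_order_dvd zP); apply/negP => /dvdn_leq.
have q0 : (0 < #|F| - 1)%N by rewrite subn_gt0 finNzRing_gt1.
by rewrite divn_gt0 // (dvdn_leq q0 d3) leqNgt ltn_Pdiv // => /(_ isT).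
Qed.

(** Write [j] as [z ^+ i] for a generator [z]. By Fermat's little theorem [j ^ (p - 1)] is 1 in [F],
    so [#|F| - 1], hence [3 * (p - 1)], divides [i * (p - 1)], and 3 divides [i]. *)
Lemma natr_cube j : (j%:R : F) != 0 -> exists g : F, g ^+ 3 = j%:R.
Proof.
move=> nz; have [z zP] := exists_generator.
have p1 : (0 < p - 1)%N by rewrite subn_gt0 prime_gt1.
have jp : (j%:R : F) ^+ (p - 1) = 1.
  apply: (mulIf nz); rewrite -exprSr mul1r subn1 prednK ?prime_gt0 //.
  by rewrite -(pFrobenius_autE charFp) pFrobenius_aut_nat.
have /(prim_rootP zP)[i ji] : (j%:R : F) ^+ (#|F| - 1) = 1.
  by have /dvdnP[n ->] := dvdF; rewrite mulnA mulnC exprM jp expr1n.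
move: jp; rewrite ji -exprM => /eqP; rewrite -(prim_order_dvd zP) => di.
have /dvdnP[n ni] : (3 %| i)%N by rewrite -(dvdn_pmul2r p1); exact: dvdn_trans di.
by exists (z ^+ n); rewrite -exprM ni.
Qed.

(** The group of all elements whose cube is a nonzero element of the prime field; the latter are
    represented by the integers [0 < j < p]. *)
Definition cube_roots : {set F} :=
  [set g | [exists j : 'I_p, (j != 0 :> nat) && (g ^+ 3 == (j : nat)%:R)]].

Local Notation c3 := #|[set g : F | g ^+ 3 == 1]|.

Lemma card_unity3_gt1 : (1 < c3)%N.
Proof.
have [w w1 w3] := exists_cube_root1.
apply: (@leq_trans #|[set w; 1]|); first by rewrite cards2 w1.
by apply/subset_leq_card/fintype.subsetP => x /set2P[]->; rewrite inE ?w3 ?expr1n.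
Qed.

Lemma cube_rootsP g : reflect (exists2 j, (j%:R : F) != 0 & g ^+ 3 = j%:R) (g \in cube_roots).
Proof.
rewrite inE; apply: (iffP existsP) => [[j /andP[j0 /eqP->]]|[j j0 gj]].
  by exists j; rewrite // (natr_pchar_eq0 charFp).
have jp := ltn_pmod j (prime_gt0 p_prime); exists (Ordinal jp) => /=.
have jj : (j %% p)%N%:R = j%:R :> F.
  by rewrite {2}(divn_eq j p) natrD natrM (pcharf0 charFp) mulr0 add0r.
by rewrite -(natr_pchar_eq0 charFp) // jj j0 gj /=.
Qed.

(** Cubing maps [cube_roots] onto the nonzero elements of the prime field, and every fibre is a
    coset of the group of cube roots of unity. *)
Lemma cube_roots_sum (C : nzRingType) (h : F -> C) :
  \sum_(g in cube_roots) h (g ^+ 3) = c3%:R * \sum_(1 <= j < p) h j%:R.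
Proof.
have injp : {in [pred j | (j < p)%N] &, injective (fun j : nat => j%:R : F)}.
  move=> i j; rewrite !inE; wlog ij : i j / (i <= j)%N.
    by move=> H ip jp e; case/orP: (leq_total i j) => /H; [|move/(_ jp ip)/(_ (esym e))]; auto.
  move=> ip jp /eqP; rewrite eq_sym -subr_eq0 -natrB // (natr_pchar_eq0 charFp); last first.
    exact: leq_ltn_trans (leq_subr _ _) jp.
  by rewrite subn_eq0 => ji; apply/eqP; rewrite eqn_leq ij.
have -> : \sum_(1 <= j < p) h j%:R = \sum_(j < p | (j != 0 :> nat)) h (j : nat)%:R.
  rewrite -(big_mkord (fun j => j != 0)%N (fun j => h j%:R)).
  rewrite [RHS]big_ltn_cond ?prime_gt0 //= big_nat_cond [RHS]big_nat_cond.
  by apply: eq_bigl => j; case: j => // j; rewrite andbT.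
rewrite mulr_sumr.
have key g : g \in cube_roots -> h (g ^+ 3) =
    \sum_(j < p | (j != 0 :> nat) && (g ^+ 3 == (j : nat)%:R)) h (j : nat)%:R.
  rewrite inE => /existsP[j /andP[j0 /eqP gj]]; rewrite (big_pred1 j) ?gj // => i.
  apply/andP/eqP => [[_ /eqP e]|->]; last by rewrite j0.
  by apply/val_inj/(injp _ _ (ltn_ord i) (ltn_ord j)).
rewrite (eq_bigr _ key) (exchange_big_dep (fun j : 'I_p => j != 0 :> nat)) /=; last first.
  by move=> g j _ /andP[].
apply: eq_bigr => j j0; rewrite sumr_const mulr_natl; congr (_ *+ _).
have nz : ((j : nat)%:R : F) != 0 by rewrite (natr_pchar_eq0 charFp).
have [g0 g0j] := natr_cube nz.
have g00 : g0 != 0 by apply: contraNneq nz => g00; rewrite -g0j g00 expr0n.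
rewrite -[RHS](card_imset _ (mulfI g00)); apply: eq_card => g; rewrite [LHS]unfold_in.
apply/andP/imsetP => [[gG /andP[_ /eqP gj]]|[x]].
  exists (g / g0); last by rewrite mulrC divfK.
  by rewrite inE expr_div_n gj g0j divff.
rewrite inE => /eqP x3 ->; rewrite exprMn g0j x3 mulr1 j0 eqxx; split=> //.
by apply/cube_rootsP; exists j; rewrite // exprMn x3 mulr1.
Qed.

End Roots.

(** * The character sum over a cone *)

Section ConeSum.
Variables (F : finFieldType) (C : numClosedFieldType) (Psi : F -> C) (p : nat).
Hypotheses (p_prime : prime p) (charFp : p \in [pchar F]).
Hypothesis dvdF : (3 * (p - 1) %| #|F| - 1)%N.
Hypotheses (Psi_neq0 : forall x, Psi x != 0).
Hypothesis PsiD : forall x y, Psi (x + y) = Psi x * Psi y.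
Variables (d : nat) (c : 'I_d -> 'I_d -> 'I_d -> F).
Variables (W : 'M[F]_d) (Y : {set 'rV[F]_d}).

Local Notation cubic := (cubic c).

Hypothesis W_sub_Y : forall w, (w <= W)%MS -> w \in Y.
Hypothesis YZ : forall a v, v \in Y -> a *: v \in Y.
Hypothesis YD : forall v w, v \in Y -> (w <= W)%MS -> v + w \in Y.
Hypothesis cubic_Y : forall v w, v \in Y -> (w <= W)%MS -> cubic (v + w) = cubic v.

(** A geometric sum: [Psi x] is a [p]-th root of unity, so its powers with exponents below [p] add
    up to [p] or 0, and the exponent 0 is left out. *)
Lemma sum_nat_mul_char x :
  \sum_(1 <= j < p) Psi (j%:R * x) = (p * (Psi x == 1))%:R - 1.
Proof.
under eq_bigr => j _ do rewrite mulr_natl (charMn Psi_neq0 PsiD).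
apply/eqP; rewrite -subr_eq0 opprB addrA subr_eq0 addrC -[X in X + _](expr0 (Psi x)).
rewrite -big_ltn ?prime_gt0 // big_mkord eq_sym; apply/eqP.
have := subrX1 (Psi x) p; rewrite (charX charFp Psi_neq0 PsiD) subrr.
case: eqP => [-> _|/eqP nz]; last first.
  by move/eqP; rewrite eq_sym mulf_eq0 subr_eq0 (negPf nz) muln0 /= => /eqP.
by under eq_bigr do rewrite expr1n; rewrite sumr_const card_ord muln1.
Qed.

(** Averaging over the scalars in [G] expresses the sum through [#|A|] and [#|Y|]. Counting orbits
    gives both modulo [c3 * (p - 1) * #|F| ^ \rank W], and the sum becomes [#|F| ^ \rank W] times an
    integer congruent to 1 modulo [c3]. Since [c3 > 1], this integer is nonzero. *)
Lemma cone_sum_lower :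
  (#|F| ^ \rank W)%:R <= `|\sum_(v in Y) Psi (cubic v)|.
Proof.
pose G := cube_roots F p; pose c3 := #|[set g : F | g ^+ 3 == 1]|.
have c3_gt1 : (1 < c3)%N := card_unity3_gt1 dvdF.
have p1 : (0 < p - 1)%N by rewrite subn_gt0 prime_gt1.
have GP := cube_rootsP p_prime charFp.
have cardG : #|G| = (c3 * (p - 1))%N.
  have := cube_roots_sum p_prime charFp dvdF (fun _ => 1 : int).
  rewrite big_const_nat iter_addr_0 sumr_const -natrM => /eqP.
  by rewrite eqr_nat => /eqP.
have G0 : 0 \notin G.
  by apply/GP => -[j nz]; rewrite expr0n /= => e; rewrite -e eqxx in nz.
have G1 : 1 \in G by apply/GP; exists 1%N; rewrite ?oner_neq0 ?expr1n.
have GM : {in G &, forall x y, x * y \in G}.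
  move=> x y /GP[i i0 xi] /GP[j j0 yj]; apply/GP; exists (i * j)%N.
    by rewrite natrM mulf_neq0.
  by rewrite exprMn xi yj natrM.
have GV : {in G, forall x, x^-1 \in G}.
  (* By Fermat's little theorem [i ^ (p - 2)] inverts [i] in the prime field. *)
  move=> x /GP[i i0 xi]; apply/GP; exists (i ^ (p - 2))%N.
    by rewrite natrX expf_neq0.
  rewrite exprVn xi natrX; apply: (mulIf i0); rewrite mulVf // -exprSr.
  have -> : ((p - 2).+1 = p - 1)%N by have := prime_gt1 p_prime; lia.
  apply/esym/(mulIf i0); rewrite -exprSr mul1r subn1 prednK ?prime_gt0 //.
  by rewrite -(pFrobenius_autE charFp) pFrobenius_aut_nat.
pose A := [set v in Y | Psi (cubic v) == 1].
have cubW w : (w <= W)%MS -> cubic w = 0.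
  move=> wW; have := cubic_Y (W_sub_Y (sub0mx _ W)) wW; rewrite add0r => ->.
  by rewrite -(scale0r 0) cubicZ expr0n mul0r.
have charG g v : g \in G -> Psi (cubic v) = 1 -> Psi (cubic (g *: v)) = 1.
  move=> /GP[j _ gj] v1; rewrite cubicZ gj mulr_natl (charMn Psi_neq0 PsiD).
  by rewrite v1 expr1n.
(* Such a set consists of [W] and of free orbits outside [W]. *)
have card_mod (B : {set 'rV[F]_d}) :
    (forall w, (w <= W)%MS -> w \in B) ->
    (forall g v w, g \in G -> v \in B -> (w <= W)%MS -> g *: v + w \in B) ->
    exists n, #|B| = (#|F| ^ \rank W * (1 + c3 * (p - 1) * n))%N.
  move=> WB Bcl.
  have := @dvdn_card_orbits _ _ G W (B :\: [set w : 'rV[F]_d | (w <= W)%MS]) G1 G0 GM GV.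
  case/(_ _ _)/dvdnP.
  - by move=> v; rewrite !inE => /andP[].
  - move=> g v w gG; rewrite !inE => /andP[vW vB] wW; rewrite Bcl // andbT submxDr //.
    have g0 : g != 0 by apply: contraNneq G0 => <-.
    apply: contra vW => /(scalemx_sub g^-1); by rewrite scalerA mulVf ?scale1r.
  move=> n Bn; exists n.
  rewrite -(cardsID [set w : 'rV[F]_d | (w <= W)%MS] B) Bn cardG.
  rewrite (finset.setIidPr _) ?card_sub_rV; first lia.
  by apply/fintype.subsetP => w; rewrite inE; exact: WB.
have [|g v w gG vY wW|b cardY] := card_mod Y; first exact: W_sub_Y.
  by rewrite YD // YZ.
have [w wW|g v w gG|a cardA] := card_mod A.
- by rewrite inE W_sub_Y //= cubW // (char0 Psi_neq0 PsiD).
- rewrite !inE => /andP[vY /eqP v1] wW; rewrite YD ?YZ //= cubic_Y ?YZ //.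
  by rewrite charG.
set S := \sum_(v in Y) _.
have eqS : (c3 * (p - 1))%:R * S = c3%:R * ((p * #|A|)%:R - #|Y|%:R).
  have -> : (c3 * (p - 1))%:R * S = \sum_(g in G) S by rewrite sumr_const cardG mulr_natl.
  have shiftS g : g \in G -> S = \sum_(v in Y) Psi (g ^+ 3 * cubic v).
    move=> gG; have g0 : g != 0 by apply: contraNneq G0 => <-.
    rewrite /S (reindex_inj (scalerI g0)) /=; apply: eq_big => [v|v _]; last by rewrite cubicZ.
    apply/idP/idP => [/(YZ g^-1)|/YZ //].
    by rewrite scalerA mulVf // scale1r.
  rewrite (eq_bigr _ shiftS) exchange_big /=.
  under eq_bigr => v _ do
    rewrite (cube_roots_sum p_prime charFp dvdF (fun x => Psi (x * cubic v)))
      sum_nat_mul_char.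
  rewrite -mulr_sumr; congr (_ * _).
  rewrite sumrB sumr_const; congr (_ - _).
  rewrite -natr_sum -big_distrr /=; congr (_ * _)%:R.
  rewrite -sum1_card [RHS](eq_bigl (fun v => (v \in Y) && (Psi (cubic v) == 1))); last first.
    by move=> v; rewrite inE.
  by rewrite [RHS]big_mkcondr.
(* The cofactor left after inserting both cardinals in [eqS] and cancelling [c3 * (p - 1)]. *)
pose z : int := 1 + c3%:Z * (p%:Z * a%:Z - b%:Z).
have -> : S = (#|F| ^ \rank W)%:R * z%:~R.
  apply: (@mulfI _ (c3 * (p - 1))%:R); first by rewrite pnatr_eq0 -lt0n muln_gt0 p1 ltnW.
  rewrite eqS cardA cardY /z !natrM !(natrD, natrM) !(rmorphD, rmorphB, rmorphM) /=.
  rewrite natrB ?prime_gt0 // -!pmulrn; ring.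
rewrite normrM normr_nat; apply: ler_peMr; rewrite ?ler0n //.
rewrite -intr_norm ler1z -gtz0_ge1 normr_gt0.
rewrite /z; move: c3_gt1; move: (p%:Z * a%:Z - b%:Z) => y; clear => lt1.
apply/eqP => e; have : (c3%:Z %| 1)%Z by apply/dvdzP; exists (- y); lia.
by rewrite dvdzE /= dvdn1 => /eqP c31; rewrite c31 in lt1.
Qed.

End ConeSum.

(** * Lower bound for cubic exponential sums *)

Section LowerBound.
Variables (F : finFieldType) (C : numClosedFieldType) (Psi : F -> C) (p : nat).
Hypotheses (p_prime : prime p) (charFp : p \in [pchar F]).
Hypothesis dvdF : (3 * (p - 1) %| #|F| - 1)%N.
Hypotheses (Psi_neq0 : forall x, Psi x != 0).
Hypothesis PsiD : forall x y, Psi (x + y) = Psi x * Psi y.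
Hypothesis Psi_nontriv : exists x, Psi x != 1.
Variables (d : nat) (c : 'I_d -> 'I_d -> 'I_d -> F).
Hypotheses (c_sym : sym3 c) (six_neq0 : 6 != 0 :> F).

Local Notation cubic := (cubic c).
Local Notation tri := (tri c).
Local Notation Q := #|F|.

Section Regular.
Variables (W : 'M[F]_d) (D : nat).
Hypothesis W_iso : isotropic c W.
Let W0 := isotropicP _ _ W_iso.
Let K := annih c W.
Let wr := \rank W.

Let Y : {set 'rV[F]_d} :=
  [set v | (v <= K)%MS && [forall w : 'rV[F]_d, (w <= W)%MS ==> (tri v v w == 0)]].

Let YP v : reflect ((v <= K)%MS /\ forall w, (w <= W)%MS -> tri v v w = 0) (v \in Y).
Proof.
rewrite inE; apply: (iffP andP) => -[vK v0]; split=> //.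
  by move=> w wW; apply/eqP; exact: (implyP (forallP v0 w) wW).
by apply/forallP => w; apply/implyP => wW; rewrite v0.
Qed.

Let E v := \sum_(w : 'rV[F]_d | (w <= W)%MS) Psi (cubic (v + w)).

(** For [v] in [K] the exponent on the coset of [v] is [cubic v] plus the linear term
    [3 * tri v v w], which is zero on [W] exactly when [v] lies in [Y]. *)
Lemma sum_fiber_annih v : (v <= K)%MS ->
  E v = if v \in Y then (Q ^ wr)%:R * Psi (cubic v) else 0.
Proof.
move=> vK; have v0 := annihP _ _ _ vK.
have -> : E v = Psi (cubic v) * \sum_(w : 'rV[F]_d | (w <= W)%MS) Psi (3 * tri v v w).
  rewrite mulr_sumr; apply: eq_bigr => w wW.
  by rewrite cubicD // (v0 w w) // [cubic w]W0 // mulr0 !addr0 PsiD.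
case: ifP => [/YP[_ v1]|/negP vY].
  under eq_bigr => w wW do rewrite v1 // mulr0 (char0 Psi_neq0 PsiD).
  by rewrite sum_sub_const mulr1 mulrC.
have /existsP[w /andP[wW nz]] : [exists w : 'rV[F]_d, (w <= W)%MS && (tri v v w != 0)].
  apply: contraT => /existsPn v1; case: vY; apply/YP; split=> // w wW.
  by apply/eqP; have := v1 w; rewrite wW negbK.
rewrite (@char_sum0 _ _ _ PsiD Psi_nontriv _ _ (fun w => 3 * tri v v w) w) ?mulr0 //.
- by move=> x y; rewrite triDr mulrDr.
- by move=> a x; rewrite triZr mulrCA.
- rewrite mulf_neq0 //; apply: contraNneq six_neq0.
  by rewrite (_ : 6 = 2 * 3); [move=> ->; rewrite mulr0|ring].
Qed.

Hypothesis codimW : (d <= wr + D)%N.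
Hypothesis W_reg :
  forall v, ~~ (v <= K)%MS -> (\rank (radical c W v) + (2 * D + 2) <= wr)%N.

(** By [W_reg] and the Weyl bound, each [E v] with [v] outside [K] is at most [Q ^ wr / Q ^ (D + 1)]
    in absolute value. In total these give at most [Q ^ (2 * wr) / Q], since [d <= wr + D], whereas
    the cone contributes at least [Q ^ (2 * wr)]. *)
Lemma regular_lower_bound :
  (Q ^ d)%:R <= `|\sum_(v : 'rV[F]_d) Psi (cubic v)| * (Q ^ (D + 1))%:R.
Proof.
set a := \sum_v _.
have Q1 : (1 < Q)%N := finNzRing_gt1 F.
have Qgt0 n : 0 < (Q ^ n)%:R :> C by rewrite ltr0n expn_gt0 ltnW.
(* The sum of all [E v] counts every vector [Q ^ wr] times. *)
have eqa : (Q ^ wr)%:R * a = \sum_v E v.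
  rewrite /E exchange_big /= -sum_sub_const; apply: eq_bigr => w _.
  by rewrite [LHS](reindex_inj (addIr w)).
have Y_lower : (Q ^ wr)%:R <= `|\sum_(v in Y) Psi (cubic v)|.
  apply: (cone_sum_lower p_prime charFp) => //.
  - by move=> w wW; apply/YP; split=> [|w' w'W]; [exact: submx_trans W_iso|exact: W0].
  - move=> b v /YP[vK v0]; apply/YP; split=> [|w wW]; first exact: scalemx_sub.
    by rewrite triZl triZm v0 // !mulr0.
  - move=> v w /YP[vK v0] wW; apply/YP.
    split=> [|x xW]; first by rewrite addmx_sub // (submx_trans wW).
    have v1 := annihP _ _ _ vK.
    by rewrite triDl !triDm (triCl c_sym w v) v0 // !v1 // W0 // !addr0.
  - move=> v w /YP[vK v0] wW; rewrite cubicD // v0 // [cubic w]W0 //.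
    by rewrite (annihP _ _ _ vK w w) // !mulr0 !addr0.
have E_upper v : ~~ (v <= K)%MS -> `|E v| * (Q ^ (D + 1))%:R <= (Q ^ wr)%:R.
  move=> vK; rewrite -(@ler_pXn2r _ 2) ?nnegrE ?mulr_ge0 ?ler0n //.
  have wb : `|E v| ^+ 2 <= (Q ^ (wr + \rank (radical c W v)))%:R.
    exact: (weyl_bound p_prime charFp).
  rewrite exprMn; apply: le_trans (ler_wpM2r _ wb) _; first by rewrite exprn_ge0 ?ler0n.
  rewrite -!natrX -natrM -!expnM -expnD ler_nat leq_pexp2l ?(ltnW Q1) //.
  have := W_reg vK; rewrite -/wr; lia.
have eqE : \sum_v E v =
    (Q ^ wr)%:R * (\sum_(v in Y) Psi (cubic v)) + \sum_(v : 'rV[F]_d | ~~ (v <= K)%MS) E v.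
  rewrite (bigID (fun v : 'rV[F]_d => (v <= K)%MS)) /=; congr (_ + _).
  rewrite (eq_bigr _ sum_fiber_annih) -big_mkcondr mulr_sumr; apply: eq_bigl => v.
  by apply: andb_idl => /YP[].
set B := \sum_(v : 'rV[F]_d | ~~ _) E v in eqE.
have B_upper : `|B| * (Q ^ (D + 1))%:R <= (Q ^ d)%:R * (Q ^ wr)%:R.
  apply: le_trans (ler_wpM2r (ler0n _ _) (ler_norm_sum _ _ _)) _.
  rewrite mulr_suml; apply: le_trans (ler_sum _ E_upper) _.
  rewrite sumr_const -[X in X <= _]mulr_natl; apply: ler_wpM2r; rewrite ?ler0n // ler_nat.
  by apply: leq_trans (max_card _) _; rewrite card_mx mul1n.
rewrite -(ler_pM2l (Qgt0 wr)) mulrA -[X in X * `|a|]normr_nat -normrM eqa eqE.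
have := lerB_dist ((Q ^ wr)%:R * (\sum_(v in Y) Psi (cubic v))) (- B).
rewrite opprK normrN normrM normr_nat => /(ler_wpM2r (ler0n C (Q ^ (D + 1)))) H.
apply: le_trans _ H; rewrite mulrBl lerBrDr.
apply: (le_trans (lerD (lexx _) B_upper)).
apply: (@le_trans _ _ ((Q ^ wr)%:R * (Q ^ wr)%:R * (Q ^ (D + 1))%:R)); last first.
  by rewrite ler_pM2r ?Qgt0 // ler_pM2l ?Qgt0.
rewrite -!natrM -natrD ler_nat [(Q ^ d * _)%N]mulnC -mulnDr -mulnA.
rewrite leq_pmul2l ?expn_gt0 ?(ltnW Q1) //.
(* One [Q ^ d] is for the claim and one for the error term; [2 <= Q] absorbs both in [Q ^ d.+1]. *)
rewrite -expnD addnn -mul2n; apply: (@leq_trans (Q ^ d.+1)).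
  by rewrite expnS leq_mul2r Q1 orbT.
by rewrite leq_pexp2l ?(ltnW Q1) // addnA addn1 ltnS.
Qed.

End Regular.

(* Codimension reached after at most [j] replacements of an isotropic space by
   a radical in it, starting from codimension [D]. *)
Fixpoint codim_bound (j D : nat) : nat :=
  if j is j'.+1 then codim_bound j' (3 * D + 2) else D.

Lemma leq_codim_bound j D : (D <= codim_bound j D)%N.
Proof. by elim: j D => //= j IHj D; apply: leq_trans (IHj _); lia. Qed.

(** Induction on [j], which bounds the codimension of [annih c W]. A [v] violating the rank
    condition of the regular case yields a radical of codimension at most [3 * D + 2], which
    replaces [W]. For [j = 0] no such [v] exists. *)
Lemma cubic_sum_lower_bound j (W : 'M[F]_d) D :
    isotropic c W -> (d <= \rank W + D)%N -> (d <= \rank (annih c W) + j)%N ->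
  (Q ^ d)%:R <= `|\sum_(v : 'rV[F]_d) Psi (cubic v)| * (Q ^ (codim_bound j D + 1))%:R.
Proof.
have Q1 : (1 < Q)%N := finNzRing_gt1 F.
elim: j W D => [|j IHj] W D W_iso codimW codimK;
  case: (pickP (fun v => ~~ (v <= annih c W)%MS &&
     (\rank W < \rank (radical c W v) + (2 * D + 2))%N)) => [v /andP[vK vW]|W_reg].
- move: vK; rewrite submx_full // -col_leq_rank; lia.
- apply: regular_lower_bound W_iso codimW _ => v vK.
  by have := W_reg v; rewrite vK /= ltnNge => /negbT; rewrite negbK.
- have radW : (radical c W v <= W)%MS by exact: capmxSl.
  apply: (IHj (radical c W v)); first exact: isotropicS W_iso; first lia.
  (* The new annihilator is strictly larger because it contains [v]. *)
  suff : (annih c W < annih c (radical c W v))%MS by move/rank_ltmx; lia.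
  rewrite ltmxE annihS //=; apply: contra vK; apply: submx_trans.
  apply/annihP => x y /radicalP[_ x0] /radicalP[yW _]; exact: x0.
apply: (@le_trans _ _ (`|\sum_v Psi (cubic v)| * (Q ^ (D + 1))%:R)).
  apply: regular_lower_bound W_iso codimW _ => v vK.
  by have := W_reg v; rewrite vK /= ltnNge => /negbT; rewrite negbK.
apply: ler_wpM2l => //; rewrite ler_nat leq_pexp2l ?(ltnW Q1) //.
by rewrite leq_add2r; apply: leq_codim_bound j.+1 D.
Qed.

End LowerBound.

(** * Descent of isotropic subspaces *)

Section IsotropicHull.
Variables (K : fieldType) (d : nat) (c : 'I_d -> 'I_d -> 'I_d -> K) (r : nat).
Hypothesis c_sym : sym3 c.

Local Notation tri := (tri c).

Definition covers_isotropic (N : 'M[K]_d) : Prop :=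
  forall W : 'M[K]_d, isotropic c W -> (d <= \rank W + r)%N -> (W <= N)%MS.

(* [N] is a sum of isotropic spaces of codimension at most [r], stated through
   its images under the automorphisms of the field fixing [c]. *)
Definition sum_of_isotropic (N : 'M[K]_d) : Prop :=
  forall (f : {rmorphism K -> K}) (N' : 'M[K]_d),
    (forall i j k, f (c i j k) = c i j k) -> covers_isotropic N' ->
    (map_mx f N <= N')%MS.

Definition vanishes_UUN (U N : 'M[K]_d) : Prop :=
  forall u v w, (u <= U)%MS -> (v <= U)%MS -> (w <= N)%MS -> tri u v w = 0.

Lemma map_isotropic_fix (f : {rmorphism K -> K}) (W : 'M[K]_d) :
  (forall i j k, f (c i j k) = c i j k) -> isotropic c W -> isotropic c (map_mx f W).
Proof.
move=> fc; move/(map_isotropic f).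
suff -> : (fun i j k => f (c i j k)) = c by [].
by apply/funext => i; apply/funext => j; apply/funext => k.
Qed.

(** While some isotropic [W] of codimension at most [r] is not contained in [N], the pair [(U, N)]
    is replaced by [(U :&: W, N + W)]. Each step costs [U] at most [r] dimensions and raises the
    rank of [N], so at most [j] steps occur. *)
Lemma extend_to_hull j e (U N : 'M[K]_d) :
    sum_of_isotropic N -> (U <= N)%MS -> vanishes_UUN U N ->
    (d <= \rank N + j)%N -> (d <= \rank U + e)%N ->
  exists U' N' : 'M[K]_d,
    [/\ sum_of_isotropic N', covers_isotropic N', (U' <= N')%MS,
        vanishes_UUN U' N' & (d <= \rank U' + (e + j * r))%N].
Proof.
elim: j e U N => [|j IHj] e U N sumN UN UUN codimN codimU.
  exists U, N; rewrite mul0n addn0; split=> // W _ _.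
  by rewrite submx_full // -col_leq_rank -(addn0 (\rank N)).
case: (EM (covers_isotropic N)) => [covN|/existsNP[W]].
  by exists U, N; split=> //; apply: leq_trans codimU _; rewrite leq_add2l leq_addr.
move=> /not_implyP[W_iso /not_implyP[codimW /negP WN]].
have capUW := mxrank_sum_cap U W.
have dUW : (\rank (U + W)%MS <= d)%N by exact: rank_leq_col.
have ltN : (\rank N < \rank (N + W)%MS)%N.
  by apply: rank_ltmx; rewrite ltmxE addsmxSl addsmx_sub submx_refl.
have [|||||U' [N' [h1 h2 h3 h4 h5]]] := IHj (e + r)%N (U :&: W)%MS (N + W)%MS.
- move=> f N' fc covN'; rewrite map_addsmx addsmx_sub sumN //=.
  by apply: covN'; [exact: map_isotropic_fix|rewrite mxrank_map].
- by apply: submx_trans (capmxSl _ _) (submx_trans UN (addsmxSl _ _)).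
- move=> u v w; rewrite !sub_capmx => /andP[uU uW] /andP[vU vW] /sub_addsmxP[[a b] ->] /=.
  rewrite triDr UUN ?submxMl // add0r.
  by apply: (isotropicP _ _ W_iso); rewrite ?submxMl.
- lia.
- lia.
by exists U', N'; split=> //; lia.
Qed.

Lemma exists_hull (W : 'M[K]_d) : isotropic c W -> (d <= \rank W + r)%N ->
  exists U N : 'M[K]_d,
    [/\ sum_of_isotropic N, covers_isotropic N, (U <= N)%MS,
        vanishes_UUN U N & (d <= \rank U + (r + r * r))%N].
Proof.
move=> W_iso codimW; apply: (@extend_to_hull r r W W) => //.
  by move=> f N fc; apply; [exact: map_isotropic_fix|rewrite mxrank_map].
by move=> u v w; exact: (isotropicP _ _ W_iso).
Qed.

(** Let [B] span a complement of [U]. For [u] in [U], the values of [tri u] on [N] with a further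
    argument in [U] vanish already, so only the at most [e * e] equations on pairs from [B]
    remain. *)
Lemma mxrank_cap_annih e (U N : 'M[K]_d) :
    (U <= N)%MS -> vanishes_UUN U N -> (d <= \rank U + e)%N ->
  (d <= \rank (N :&: annih c N)%MS + (e + e * e))%N.
Proof.
move=> UN UUN codimU; pose B := row_base (U^C)%MS.
have rB : (\rank (U^C)%MS <= e)%N by rewrite mxrank_compl leq_subLR.
have annB := mxrank_annih c B.
have capUB := mxrank_sum_cap U (annih c B).
have dUB : (\rank (U + annih c B)%MS <= d)%N by exact: rank_leq_col.
have le : (\rank (U :&: annih c B)%MS <= \rank (N :&: annih c N)%MS)%N.
  apply: mxrankS; rewrite sub_capmx (submx_trans (capmxSl _ _) UN) /=.
  apply/rV_subP => u; rewrite sub_capmx => /andP[uU /annihP u0].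
  have dec (x : 'rV_d) : exists y z : 'rV_d, [/\ x = y + z, (y <= U)%MS & (z <= B)%MS].
    have /sub_addsmxP[[a b] ->] : (x <= U + U^C)%MS by exact/submx_full/addsmx_compl_full.
    exists (a *m U), (b *m U^C%MS); split=> //; first exact: submxMl.
    by rewrite eq_row_base submxMl.
  apply/annihP => v w vN wN.
  have [a [b [ev aU bB]]] := dec v; have [a' [b' [ew aU' bB']]] := dec w.
  have bN : (b <= N)%MS.
    by rewrite -(addKr a b) addmx_sub ?eqmx_opp ?(submx_trans aU) // -ev.
  rewrite ev triDm (UUN u a w) // add0r ew triDr (u0 b b') // addr0.
  by rewrite triCr // UUN.
have ee : (\rank (U^C)%MS * \rank (U^C)%MS <= e * e)%N by rewrite leq_mul.
lia.
Qed.

End IsotropicHull.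

(** * Descent along the Frobenius map *)

Section FrobeniusDescent.
Variables (k : finFieldType) (K : fieldType) (iota : {rmorphism k -> K}).
Variables (p m : nat).
Hypotheses (p_prime : prime p) (cardk : #|k| = (p ^ m)%N).

Let charK : p \in [pchar K].
Proof. by rewrite (fmorph_pchar iota) (card_finPcharP cardk). Qed.

(* The unused arguments are what makes this map a ring morphism. *)
Definition frob of prime p & #|k| = (p ^ m)%N & {rmorphism k -> K} := fun x : K => x ^+ #|k|.
Local Notation fr := (frob p_prime cardk iota).

Fact frob_is_zmod_morphism : zmod_morphism fr.
Proof.
have h : [pchar K].-nat #|k|.
  by rewrite cardk pnatX; apply/orP; left; rewrite pnatE.
by move=> x y; rewrite /frob exprDn_pchar // exprNn_pchar.
Qed.

Fact frob_is_monoid_morphism : monoid_morphism fr.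
Proof. by split=> [|x y]; rewrite /frob ?expr1n ?exprMn. Qed.

HB.instance Definition _ := GRing.isZmodMorphism.Build K K fr frob_is_zmod_morphism.
HB.instance Definition _ := GRing.isMonoidMorphism.Build K K fr frob_is_monoid_morphism.

Lemma frob_iota x : fr (iota x) = iota x.
Proof. by rewrite /frob -rmorphXn expf_card. Qed.

Lemma frob_fixed x : fr x = x -> exists a, iota a = x.
Proof.
move=> fx; have := congr1 (map_poly iota) (finField_genPoly k).
rewrite rmorphB /= map_polyXn map_polyX rmorph_prod => /(congr1 (fun q => q.[x])).
rewrite !hornerE [x ^+ _]fx subrr horner_prod => /esym/eqP/prodf_eq0[a _].
by rewrite /= map_polyXsubC hornerXsubC subr_eq0 => /eqP ->; exists a.
Qed.

(** A basis of [N] normalized to be the identity on suitable columns is determined by [N] and these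
    columns. Frobenius preserves the space and the normalization, so it fixes all entries. *)
Lemma frob_stable_descent d (N : 'M[K]_d) : (map_mx fr N <= N)%MS ->
  exists n (B : 'M[k]_(n, d)), (map_mx iota B :=: N)%MS.
Proof.
move=> stN; pose R := row_base N.
have fullR : row_full R^T by rewrite /row_full mxrank_tr; exact: row_base_free.
have unitG := fullrowsub_unit fullR; set g := fullrankfun fullR in unitG.
pose B := R^T *m invmx (rowsub g R^T).
have gB : rowsub g B = 1%:M by rewrite rowsubE mulmxA -rowsubE mulmxV.
have eqB : (B^T :=: N)%MS.
  rewrite trmx_mul trmxK; apply: eqmx_trans (eq_row_base N).
  by apply: eqmxMfull; rewrite row_full_unit unitmx_tr unitmx_inv.
have frB : map_mx fr B = B.
  have : (map_mx fr B^T <= B^T)%MS.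
    by rewrite eqB; apply: submx_trans stN; rewrite map_submx eqB.
  case/submxP => X /(congr1 trmx); rewrite map_trmx trmxK trmx_mul trmxK => eqX.
  have := congr1 (rowsub g) eqX; rewrite [RHS]rowsubE mulmxA -rowsubE gB mul1mx.
  rewrite -map_mxsub gB map_mx1 => X1.
  by rewrite eqX -X1 mulmx1.
clearbody B.
have exB i j : exists a, iota a == B j i.
  have /frob_fixed[a <-] : fr (B j i) = B j i by rewrite -[in RHS]frB mxE.
  by exists a.
exists (\rank N), (\matrix_(i, j) xchoose (exB i j)).
rewrite (_ : map_mx _ _ = B^T) //; apply/matrixP => i j; rewrite !mxE.
by apply/eqP; exact: (xchooseP (exB i j)).
Qed.

(** The Frobenius image of the hull [N] is again a sum of isotropic spaces of codimension at most
    [r], so [N] contains it. Hence [N] comes from some [B] over [k], and base change preserves the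
    rank of [B :&: annih c B]. *)
Lemma isotropic_descent d (c : 'I_d -> 'I_d -> 'I_d -> k) r (W : 'M[K]_d) :
    sym3 c -> isotropic (fun i j l => iota (c i j l)) W -> (d <= \rank W + r)%N ->
  exists2 W' : 'M[k]_d, isotropic c W' &
    (d <= \rank W' + (r + r * r + (r + r * r) * (r + r * r)))%N.
Proof.
move=> c_sym W_iso codimW; have c'_sym := sym3_map iota c_sym.
have [U [N [sumN covN UN UUN codimU]]] := exists_hull W_iso codimW.
have [|n [B eqB]] := @frob_stable_descent d N.
  by apply: sumN => // i j l; exact: frob_iota.
have codimN := mxrank_cap_annih c'_sym UN UUN codimU.
exists (B :&: annih c B)%MS.
  by apply: submx_trans (capmxSr _ _) _; apply: annihS; exact: capmxSl.
rewrite -(mxrank_map iota) map_capmx map_annih.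
apply: leq_trans codimN _; rewrite leq_add2r; apply: mxrankS; apply: capmxS.
  by rewrite eqB.
by apply: annihS; rewrite eqB.
Qed.

End FrobeniusDescent.

(** * Homogeneous polynomials *)

Section HomogeneousPolynomials.
Variables (K : fieldType) (d : nat).
Implicit Types P Q : {mpoly K[d]}.

(** Every monomial of positive degree is divisible by a variable. *)
Lemma dhomog_split n P : P \is n.+1.-homog ->
  exists2 Q : 'I_d -> {mpoly K[d]},
    (forall i, Q i \is n.-homog) & P = \sum_i 'X_i * Q i.
Proof.
move=> /dhomogP homP; rewrite (mpolyE P) big_seq.
pose S P := exists2 Q : 'I_d -> {mpoly K[d]},
    (forall i, Q i \is n.-homog) & P = \sum_i 'X_i * Q i.
apply: (big_ind S) => [|P1 P2 [Q1 h1 e1] [Q2 h2 e2]|m /homP /= degm].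
- by exists (fun=> 0) => [i|]; [exact: dhomog0|rewrite big1 // => i _; rewrite mulr0].
- exists (fun i => Q1 i + Q2 i) => [i|]; first exact: rpredD.
  by rewrite e1 e2 -big_split; apply: eq_bigr => i _; rewrite mulrDr.
have [i mi] : exists i, m i != 0%N.
  case: (pickP (fun i => m i != 0%N)) => [i mi|m0]; first by exists i.
  have : mdeg m = n.+1 by [].
  by rewrite mdegE big1 // => i _; apply/eqP; have /negbFE := m0 i.
have Um : (U_(i) <= m)%MM by rewrite lep1mP.
exists (fun j => if j == i then P@_m *: 'X_[m - U_(i)] else 0) => [j|].
  case: eqP => _; last exact: dhomog0.
  apply/dhomogZ; rewrite dhomogX; apply/eqP/succn_inj.
  by rewrite -[LHS]addn1 -(mdeg1 i) -[LHS]mdegD submK.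
rewrite (bigD1 i) //= eqxx big1 ?addr0 => [|j /negPf ->]; last exact: mulr0.
by rewrite -scalerAr -mpolyXD addmC submK.
Qed.

Lemma dhomog0_const P : P \is 0.-homog -> P = (P@_0%MM)%:MP.
Proof.
move=> homP; apply/mpolyP => m; rewrite mcoeffC; case: eqP => [->|/eqP m0].
  by rewrite mulr1.
by rewrite mulr0 (dhomog_nemf_coeff homP) // mdeg_eq0.
Qed.

Lemma dhomog1_linear P : P \is 1.-homog ->
  exists a : 'I_d -> K, P = \sum_i 'X_i * (a i)%:MP.
Proof.
case/dhomog_split => Q homQ ->; exists (fun i => (Q i)@_0%MM).
by apply: eq_bigr => i _; rewrite -dhomog0_const.
Qed.

Lemma dhomog_map (L : fieldType) (f : {rmorphism K -> L}) n P :
  P \is n.-homog -> map_mpoly f P \is n.-homog.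
Proof.
move/dhomogP => homP; apply/dhomogP => m; rewrite mcoeff_msupp mcoeff_map_mpoly => nz.
by apply: homP; rewrite mcoeff_msupp -(fmorph_eq0 f).
Qed.

Lemma exists_tensor P : P \is 3.-homog ->
  exists c : 'I_d -> 'I_d -> 'I_d -> K,
    P = \sum_i 'X_i * \sum_j 'X_j * \sum_l 'X_l * (c i j l)%:MP.
Proof.
case/dhomog_split => Q homQ ->.
have ex i : exists c : 'I_d -> 'I_d -> K, Q i = \sum_j 'X_j * \sum_l 'X_l * (c j l)%:MP.
  have [Q' homQ' ->] := dhomog_split (homQ i).
  have [c cP] := choice (fun j => dhomog1_linear (homQ' j)).
  by exists c; apply: eq_bigr => j _; rewrite -cP.
have [c cP] := choice ex.
by exists c; apply: eq_bigr => i _; rewrite -cP.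
Qed.

(** The coefficients are averaged over the six permutations of the indices. Allowing any [f] lets
    one tensor serve over the algebraic closure and over the finite extensions. *)
Lemma exists_sym_tensor P : (6 != 0 :> K) -> P \is 3.-homog ->
  exists2 c : 'I_d -> 'I_d -> 'I_d -> K, sym3 c &
    forall (L : fieldType) (f : {rmorphism K -> L}) (v : 'rV[L]_d),
      (map_mpoly f P).@[fun i => v 0 i] = cubic (fun i j l => f (c i j l)) v.
Proof.
move=> six_neq0 /exists_tensor[b defP].
pose s i j l := b i j l + b i l j + b j i l + b j l i + b l i j + b l j i.
exists (fun i j l => 6^-1 * s i j l).
  by split=> i j l /=; congr (_ * _); rewrite /s; ring.
move=> L f v; pose T (g : 'I_d -> 'I_d -> 'I_d -> L) :=
  \sum_i \sum_j \sum_l g i j l * v 0 i * v 0 j * v 0 l.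
have T12 g : T (fun i j l => g j i l) = T g.
  rewrite /T exchange_big; apply: eq_bigr => i _; apply: eq_bigr => j _.
  by apply: eq_bigr => l _; ring.
have T23 g : T (fun i j l => g i l j) = T g.
  rewrite /T; apply: eq_bigr => i _; rewrite exchange_big; apply: eq_bigr => j _.
  by apply: eq_bigr => l _; ring.
have TD g h : T (fun i j l => g i j l + h i j l) = T g + T h.
  rewrite /T -big_split /=; apply: eq_bigr => i _; rewrite -big_split /=.
  apply: eq_bigr => j _; rewrite -big_split /=; apply: eq_bigr => l _ /=; ring.
pose fb i j l := f (b i j l).
have -> : (map_mpoly f P).@[fun i => v 0 i] = T fb.
  have gXM (R : 'I_d -> {mpoly K[d]}) : (map_mpoly f (\sum_i 'X_i * R i)).@[fun i => v 0 i] =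
      \sum_i v 0 i * (map_mpoly f (R i)).@[fun i => v 0 i].
    rewrite (rmorph_sum (map_mpoly f)) (rmorph_sum (meval _)) /=.
    by apply: eq_bigr => i _; rewrite (rmorphM (map_mpoly f)) /= mevalM map_mpolyX mevalXU.
  rewrite defP gXM; apply: eq_bigr => i _; rewrite gXM mulr_sumr.
  apply: eq_bigr => j _; rewrite gXM !mulr_sumr; apply: eq_bigr => l _.
  by rewrite map_mpolyC mevalC /fb; ring.
have six_neq0' : 6 != 0 :> L by rewrite -(rmorph_nat f) fmorph_eq0.
apply: (mulfI six_neq0'); rewrite /cubic triE.
pose s' i j l := fb i j l + fb i l j + fb j i l + fb j l i + fb l i j + fb l j i.
transitivity (T s').
  (* The two transpositions generate all permutations, so the six summands have the same [T]. *)
  have e1 := T23 fb; have e2 := T12 fb.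
  have e3 : T (fun i j l => fb j l i) = T fb := etrans (T12 (fun i j l => fb i l j)) e1.
  have e4 : T (fun i j l => fb l i j) = T fb := etrans (T23 (fun i j l => fb j i l)) e2.
  have e5 : T (fun i j l => fb l j i) = T fb := etrans (T23 (fun i j l => fb j l i)) e3.
  by rewrite /s' !TD /= e1 e2 e3 e4 e5; ring.
rewrite !mulr_sumr; apply: eq_bigr => i _; rewrite mulr_sumr; apply: eq_bigr => j _.
rewrite mulr_sumr; apply: eq_bigr => l _.
rewrite rmorphM fmorphV rmorph_nat !mulrA divff // mul1r.
by rewrite /s !rmorphD.
Qed.

(** Only products of degree 3 survive the projection to degree 3, and such a product of two forms of
    positive degree has a linear factor. The common kernel of these at most [r] linear forms is
    [W]. *)
Lemma vanishing_subspace r P (l Q : 'I_r -> {mpoly K[d]}) :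
    (forall i, exists2 e, (0 < e)%N & l i \is e.-homog) ->
    (forall i, exists2 e, (0 < e)%N & Q i \is e.-homog) ->
    P \is 3.-homog -> P = \sum_(i < r) l i * Q i ->
  exists2 W : 'M[K]_d, (d <= \rank W + r)%N &
    forall v : 'rV_d, (v <= W)%MS -> P.@[fun i => v 0 i] = 0.
Proof.
move=> homl homQ homP defP.
have lin (R : {mpoly K[d]}) : R \is 1.-homog ->
    exists a : 'cV[K]_d, forall v : 'rV_d, R.@[fun i => v 0 i] = (v *m a) 0 0.
  case/dhomog1_linear => a ->; exists (\col_i a i) => v.
  rewrite (rmorph_sum (meval _)) mxE; apply: eq_bigr => i _ /=.
  by rewrite mevalM mevalXU mevalC mxE.
have ex i : exists a : 'cV[K]_d, forall v : 'rV_d, v *m a = 0 ->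
    (pihomog mdeg 3 (l i * Q i)).@[fun i => v 0 i] = 0.
  have [e e0 he] := homl i; have [e' e'0 he'] := homQ i.
  have hM := dhomogM he he'; case: (eqVneq (e + e')%N 3) => [ee|ne]; last first.
    by exists 0 => v _; rewrite (pihomog_ne0 _ hM) ?meval0 // eq_sym.
  have [e1|e1] : e = 1%N \/ e' = 1%N by lia.
    rewrite e1 in he; have [a av] := lin _ he; exists a => v va0.
    by rewrite ee in hM; rewrite pihomog_dE // mevalM av va0 mxE mul0r.
  rewrite e1 in he'; have [a av] := lin _ he'; exists a => v va0.
  by rewrite ee in hM; rewrite pihomog_dE // mevalM av va0 mxE mulr0.
have [a aP] := choice ex.
exists (kermx (\matrix_(j, i) a i j 0)).
  rewrite mxrank_ker -leq_subLR subKn ?rank_leq_row //; exact: rank_leq_col.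
move=> v; rewrite sub_kermx => /eqP va0.
rewrite -(pihomog_dE homP) defP (raddf_sum (pihomog mdeg 3)) /=.
rewrite (raddf_sum (meval _)) /= big1 // => i _.
apply: aP.
have := congr1 (fun M : 'rV_r => M 0 i) va0; rewrite /= !mxE => va0i.
apply/rowP => j; rewrite ord1 [RHS]mxE [LHS]mxE -[RHS]va0i.
by apply: eq_bigr => j' _; rewrite mxE.
Qed.

End HomogeneousPolynomials.

(** Splitting off the variables gives a decomposition of length [d], so a minimum exists and [xget]
    does not return its default. *)
Lemma alg_rank_decomp (k : fieldType) (kbar : closedFieldType)
    (iota : {rmorphism k -> kbar}) (d : nat) (P : {mpoly k[d]}) :
    P \is 3.-homog ->
  exists2 r, has_rank_decomp iota P r & alg_rank iota P = (2 * r)%N.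
Proof.
move=> homP; rewrite /alg_rank.
have exr : exists r, `[< has_rank_decomp iota P r >].
  exists d; apply/asboolP; have [Q homQ defP] := dhomog_split homP.
  exists (fun i => 'X_i), (fun i => map_mpoly iota (Q i)); split.
  - by move=> i; exists 1%N; rewrite // dhomogX; apply/eqP/mdeg1.
  - by move=> i; exists 2%N => //; exact: dhomog_map.
  - rewrite defP (rmorph_sum (map_mpoly iota)); apply: eq_bigr => i _.
    by rewrite (rmorphM (map_mpoly iota)) /= map_mpolyX.
case: (ex_minnP exr) => r /asboolP rP rmin.
set S := (X in xget _ X); have [? _] : S (xget 0%N S); last by exists (xget 0%N S).
apply: xgetPex; exists r; split=> // s sP; apply: rmin; exact/asboolP.
Qed.

(** * Bias over the extensions *)

(** [p ^ 6 - 1] divides [p ^ N - 1] and equals [p - 1] times [1 + p + ... + p ^ 5]; this sum is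
    divisible by 3 whether [p] is 1 or 2 modulo 3. *)
Lemma dvdn_pred_exp6 p N : prime p -> (3 < p)%N -> (6 %| N)%N ->
  (3 * (p - 1) %| p ^ N - 1)%N.
Proof.
move=> p_prime p_gt3 /dvdnP[n ->].
rewrite [(n * 6)%N]mulnC expnM !subn1 predn_exp; apply: dvdn_mulr.
rewrite predn_exp [(3 * _)%N]mulnC.
rewrite dvdn_pmul2l; last by rewrite -subn1 subn_gt0 ltnW // ltnW.
have ndvd : ~~ (3 %| p)%N by rewrite dvdn_prime2 // eq_sym neq_ltn p_gt3 orbT.
have [r r3 pr] : exists2 r, (r == 1%N) || (r == 2%N) & p = r %[mod 3].
  exists (p %% 3)%N; last by rewrite modn_mod.
  by move: ndvd (ltn_pmod p (isT : 0 < 3)%N); rewrite /dvdn; case: (p %% 3)%N => [|[|[|]]].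
rewrite /dvdn -modn_summ (eq_bigr (fun i : 'I_6 => r ^ i %% 3)%N) => [|i _]; last first.
  by rewrite -modnXm pr modnXm.
by rewrite !big_ord_recr big_ord0; case/orP: r3 => /eqP ->.
Qed.

Section Trace.
Variables (k : finFieldType) (L : fieldExtType k).

Lemma ext_traceD (x y : L) : ext_trace (x + y) = ext_trace x + ext_trace y.
Proof.
by rewrite /ext_trace -big_split; apply: eq_bigr => i _; rewrite mulrDl linearD.
Qed.

Lemma ext_trace_scalar (a : k) : ext_trace (a *: 1 : L) = a * (\dim {:L})%:R.
Proof.
rewrite /ext_trace (eq_bigr (fun=> a)) => [|i _]; last first.
  have b : basis_of {:L} (vbasis {:L}) := vbasisP _.
  by rewrite -scalerAl mul1r linearZ /= (coord_free _ _ (basis_free b)) eqxx mulr1.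
by rewrite sumr_const card_ord mulr_natr.
Qed.

Lemma card_finvect : #|finvect_type L| = (#|k| ^ \dim {:L})%N.
Proof.
by rewrite -(@card_vspacef k (finvect_type L) (Vector.class L)) card_vspace.
Qed.

End Trace.

Lemma limn_einf_le (R : realType) (u : nat -> \bar R) (t : \bar R) :
  (forall n, exists2 i, (n <= i)%N & (u i <= t)%E) -> (limn_einf u <= t)%E.
Proof.
move=> ut; rewrite limn_einf_lim (cvg_lim _ (@cvg_einfs_sup _ u)) //.
apply: ge_ereal_sup => _ [n _ <-]; have [i ni uit] := ut n.
by apply: le_trans uit; apply: ereal_inf_lbound; exists i.
Qed.

Section Bias.
Variables (R : realType) (k : finFieldType) (psi : k -> R[i]).
Variables (L : nat -> fieldExtType k) (d : nat) (P : {mpoly k[d]}).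

(** For [y = #|k| ^ n] the assumption reads [tilde_b_ >= y ^ (- D)], and [b_] is minus twice the
    logarithm of [tilde_b_] to the base [y]. *)
Lemma b_le (n D : nat) : (0 < n)%N ->
  ((#|k| ^ n) ^ d)%:R <= `|a_ psi L P n| * ((#|k| ^ n) ^ D)%:R ->
  (b_ psi L P n <= (2 * D)%:R%:E)%E.
Proof.
move=> n0 lower; pose y : R := #|k|%:R ^+ n; pose N := ComplexField.Normc.normc (a_ psi L P n).
have y1 : 1 < y by rewrite exprn_egt1 -?lt0n // ltr1n finNzRing_gt1.
have y0 : 0 < y by apply: lt_trans y1.
have {lower}lower : y ^+ d <= N * y ^+ D.
  rewrite -lecR rmorphM /= !rmorphXn /= !rmorph_nat.
  by move: lower; rewrite !natrX.
have tbE : tilde_b_ psi L P n = N / y ^+ d by rewrite /tilde_b_ -exprM.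
rewrite /b_; case: ifP => [tb0|_].
  (* The lower bound makes the sum nonzero, which excludes the infinite value. *)
  move: lower; have : N = 0.
    by move: tb0; rewrite tbE mulf_eq0 invr_eq0 expf_eq0 (gt_eqF y0) andbF orbF => /eqP.
  by move=> ->; rewrite mul0r leNgt exprn_gt0.
have tb1 : 1 <= tilde_b_ psi L P n * y ^+ D.
  rewrite tbE mulrAC (ler_pdivlMr _ _ (exprn_gt0 d y0)). by rewrite mul1r.
have tb_gt0 : 0 < tilde_b_ psi L P n.
  by rewrite -(pmulr_lgt0 _ (exprn_gt0 D y0)); apply: lt_le_trans tb1.
have lny : 0 < ln y by exact: ln_gt0.
move: (tilde_b_ psi L P n) tb_gt0 tb1 => tb tb_gt0 tb1; rewrite -/y.
have := ln_ge0 tb1.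
have yD : 0 < y ^+ D by rewrite exprn_gt0.
rewrite (lnM tb_gt0 yD) (lnXn _ y0) => le.
rewrite lee_fin mulrA ler_pdivrMr // natrM.
move: le; rewrite -mulr_natl; lra.
Qed.

Hypothesis psi_char : additive_character psi.
Hypothesis psi_nontriv : nontrivial psi.
Variables (p m : nat).
Hypotheses (p_prime : prime p) (p_gt3 : (3 < p)%N) (cardk : #|k| = (p ^ m)%N).
Hypothesis dimL : forall n, (0 < n)%N -> \dim {: L n} = n.
Hypothesis homP : P \is 3.-homog.
Variables (kbar : closedFieldType) (iota : {rmorphism k -> kbar}).

Let charkp : p \in [pchar k]. Proof. exact: card_finPcharP cardk p_prime. Qed.

Lemma six_neq0 : 6 != 0 :> k.
Proof.
rewrite -(dvdn_pcharf charkp); apply/negP => p6.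
have : p \in [:: 2; 3]%N by rewrite (_ : [:: 2; 3] = primes 6)%N // mem_primes p_prime p6.
by rewrite !inE => /orP[] /eqP p23; move: p_gt3; rewrite p23.
Qed.

(** The degree [n] is a multiple of 6, so that nonzero elements of the prime field become cubes, and
    prime to [p], so that the trace keeps the character nontrivial. Descent from codimension [r]
    reaches codimension [E]. *)
Lemma bounded_rank_b_le (r : nat) (i : nat) (e := (r + r * r)%N) (E := (e + e * e)%N)
    (n := (6 * (p * i + 1))%N) : (alg_rank iota P <= r)%N ->
  (b_ psi L P n <= (2 * (codim_bound E E + 1))%:R%:E)%E.
Proof.
move=> rk; have n0 : (0 < n)%N by rewrite muln_gt0 addn1.
have [s [l [Q [homl homQ defP]]] rks] := alg_rank_decomp iota homP.
have sr : (s <= r)%N by lia.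
have [c c_sym cP] := exists_sym_tensor six_neq0 homP.
have [W codimW W0] := vanishing_subspace homl homQ (dhomog_map iota homP) defP.
have W_iso : isotropic (fun i j l => iota (c i j l)) W.
  apply: isotropic_cubic; [exact: sym3_map|by rewrite -(rmorph_nat iota) fmorph_eq0 six_neq0|].
  by move=> v /W0; rewrite cP.
have codimW' : (d <= \rank W + r)%N by apply: leq_trans codimW _; rewrite leq_add2l.
have [W' W'_iso codimW''] := isotropic_descent p_prime cardk c_sym W_iso codimW'.
pose F : finFieldType := finvect_type (L n).
pose f : {rmorphism k -> F} := in_alg (L n).
pose Psi (x : F) : R[i] := psi (ext_trace (x : L n)).
have cardF : #|F| = (#|k| ^ n)%N by rewrite [LHS]card_finvect dimL.
have charF : p \in [pchar F] by rewrite (fmorph_pchar f).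
have dvdF : (3 * (p - 1) %| #|F| - 1)%N.
  rewrite cardF cardk -expnM; apply: dvdn_pred_exp6 => //.
  by apply/dvdn_mull/dvdn_mulr.
have Psi_nontriv : exists x, Psi x != 1.
  (* The trace of the scalar [x / n] is [x], as [n] is invertible in [k]. *)
  have [x psix] := psi_nontriv; exists (f (x / n%:R)).
  rewrite /Psi /f /= ext_trace_scalar dimL // divfK //.
  rewrite -(dvdn_pcharf charkp) Euclid_dvdM // negb_or dvdn_addr ?dvdn_mulr // dvdn1.
  rewrite (dvdn_pcharf charkp) six_neq0; lia.
have eqa : a_ psi L P n = \sum_(v : 'rV[F]_d) Psi (cubic (fun i j l => f (c i j l)) v).
  rewrite /a_ (reindex (fun v : 'rV[F]_d => [ffun i => v 0 i])) /=; last first.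
    exists (fun v => \row_i v i) => v _; first by apply/rowP => j; rewrite mxE ffunE.
    by apply/ffunP => j; rewrite ffunE mxE.
  apply: eq_bigr => v _; rewrite /psi_ /Psi; congr (psi (ext_trace _)).
  by rewrite -(cP _ f); apply: meval_eq => j; rewrite ffunE.
apply: b_le => //; rewrite eqa -cardF.
have W'F_iso := map_isotropic f W'_iso.
have codimF : (d <= \rank (map_mx f W') + E)%N by rewrite mxrank_map.
apply: (cubic_sum_lower_bound p_prime charF dvdF _ _ Psi_nontriv _ _ W'F_iso codimF).
- by move=> x; rewrite /Psi; apply: psi_char.1.
- by move=> x y; rewrite /Psi -psi_char.2; congr psi; exact: ext_traceD.
- exact: sym3_map.
- by rewrite -(rmorph_nat f) fmorph_eq0 six_neq0.
(* An isotropic space lies in its own annihilator, so [E] also bounds the codimension of the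
   latter. *)
- by apply: leq_trans codimF _; rewrite leq_add2r; apply: mxrankS.
Qed.

End Bias.

Theorem theorem3p1 (R : realType) (p m : nat) (p_prime : prime p)
    (p_gt3 : (3 < p)%N) (m_gt0 : (0 < m)%N) (c : R) (c_gt0 : 0 < c) :
  exists2 t : R, 0 < t &
    (forall (k : finFieldType) (psi : k -> R[i])
        (L : nat -> fieldExtType k)
        (kbar : closedFieldType) (iota : {rmorphism k -> kbar})
        (d : nat) (P : {mpoly k[d]}),
      #|k| = (p ^ m)%N ->
      additive_character psi -> nontrivial psi ->
      (forall n, (0 < n)%N -> \dim {: L n} = n) ->
      integralRange iota ->
      P != 0 -> P \is 3.-homog -> (alg_rank iota P)%:R <= c ->
      (b_inf psi L P <= t%:E)%E) /\
    (exists N : nat,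
      forall (k : finFieldType) (psi : k -> R[i])
        (L : nat -> fieldExtType k)
        (kbar : closedFieldType) (iota : {rmorphism k -> kbar})
        (d : nat) (P : {mpoly k[d]}),
      #|k| = (p ^ m)%N ->
      additive_character psi -> nontrivial psi ->
      (forall n, (0 < n)%N -> \dim {: L n} = n) ->
      integralRange iota ->
      P != 0 -> P \is 3.-homog -> (alg_rank iota P)%:R <= c ->
      exists n : nat, [/\ (0 < n)%N, (n <= N)%N & (b_ psi L P n <= t%:E)%E]).
Proof.
pose r := Num.bound c.
have rank_le (k : finFieldType) (kbar : closedFieldType) (iota : {rmorphism k -> kbar})
    d (P : {mpoly k[d]}) : (alg_rank iota P)%:R <= c -> (alg_rank iota P <= r)%N.
  by move=> rk; rewrite -(ler_nat R) (le_trans rk) // ltW // archi_boundP // ltW.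
pose e := (r + r * r)%N; pose E := (e + e * e)%N.
exists (2 * (codim_bound E E + 1))%:R; first by rewrite ltr0n muln_gt0 addn1.
split=> [|]; last exists 6%N.
  move=> k psi L kbar iota d P cardk psi_char psi_nt dimL _ _ homP /rank_le rk.
  (* The degrees [6 * (p * n + 1)] are unbounded, so every tail contains a value at most [t]. *)
  apply: limn_einf_le => n; exists (6 * (p * n + 1))%N; last first.
    exact: (bounded_rank_b_le psi_char psi_nt p_prime p_gt3 cardk dimL homP n rk).
  by have := prime_gt0 p_prime; nia.
move=> k psi L kbar iota d P cardk psi_char psi_nt dimL _ _ homP /rank_le rk.
(* Taking [i = 0] gives the degree 6. *)
have := bounded_rank_b_le psi_char psi_nt p_prime p_gt3 cardk dimL homP 0 rk.
by rewrite muln0 => ?; exists 6%N.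
Qed.
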